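(* Let $n\geqslant 3$ be an integer, and let $$h_{C_n}(x)=\sum_{k=0}^n\binom{2n}{2k}x^k,\qquad h_{D_n}(x)=h_{C_n}(x)-2nx(1+x)^{n-2}.$$ Let $x_{n,1}^c<x_{n,2}^c<\cdots<x_{n,n}^c$ be the zeros of $h_{C_n}(x)$, and let $x_{n,1}^d<x_{n,2}^d<\cdots<x_{n,n}^d$ be the zeros of $h_{D_n}(x)$. Then the following hold. (i) If $n=2m$, then $$x_{n,1}^{c}<x_{n,1}^{d}<x_{n,2}^{d}<x_{n,2}^{c}<\cdots<x_{n,n-1}^{c}<x_{n,n-1}^{d}<x_{n,n}^{d}<x_{n,n}^{c};$$ that is, $x_{n,j}^{c}<x_{n,j}^{d}<x_{n,j+1}^{d}<x_{n,j+1}^{c}$ for every odd $j$ with $1\leqslant j\leqslant n-1$, and $x_{n,j+1}^{c}<x_{n,j+2}^{c}$ for every odd $j$ with $1\leqslant j\leqslant n-3$. (ii) If $n=2m+1$ with $m$ even, then $$x_{n,1}^{c}<x_{n,1}^{d}<x_{n,2}^{d}<x_{n,2}^{c}<\cdots<x_{n,m}^{d}<x_{n,m}^{c}<x_{n,m+1}^{c}=x_{n,m+1}^{d}=-1$$ $$<x_{n,m+2}^{c}<x_{n,m+2}^{d}<\cdots<x_{n,n-1}^{c}<x_{n,n-1}^{d}<x_{n,n}^{d}<x_{n,n}^{c};$$ that is, $x_{n,m+1}^{c}=x_{n,m+1}^{d}=-1$; the zeros less than $-1$ are ordered in consecutive blocks $x_{n,j}^{c}<x_{n,j}^{d}<x_{n,j+1}^{d}<x_{n,j+1}^{c}$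 for $j=1,3,\ldots,m-1$, with $x_{n,j+1}^{c}<x_{n,j+2}^{c}$ between successive blocks; and the zeros greater than $-1$ are ordered in consecutive blocks $x_{n,j}^{c}<x_{n,j}^{d}<x_{n,j+1}^{d}<x_{n,j+1}^{c}$ for $j=m+2,m+4,\ldots,n-1$, with $x_{n,j+1}^{c}<x_{n,j+2}^{c}$ between successive blocks. (iii) If $n=2m+1$ with $m$ odd, then $$x_{n,1}^{c}<x_{n,1}^{d}<x_{n,2}^{d}<x_{n,2}^{c}<\cdots<x_{n,m}^{c}<x_{n,m}^{d}<x_{n,m+1}^{c}=x_{n,m+1}^{d}=-1$$ $$<x_{n,m+2}^{d}<x_{n,m+2}^{c}<\cdots<x_{n,n-1}^{c}<x_{n,n-1}^{d}<x_{n,n}^{d}<x_{n,n}^{c};$$ that is, $x_{n,m+1}^{c}=x_{n,m+1}^{d}=-1$; the zeros less than $-1$ are ordered in consecutive blocks $x_{n,j}^{c}<x_{n,j}^{d}<x_{n,j+1}^{d}<x_{n,j+1}^{c}$ for $j=1,3,\ldots,m-2$ (no such block if $m=1$), with $x_{n,j+1}^{c}<x_{n,j+2}^{c}$ after each block, followed by $x_{n,m}^{c}<x_{n,m}^{d}<-1$; and the zeros greater than $-1$ begin with $-1<x_{n,m+2}^{d}<x_{n,m+2}^{c}$, followed by consecutive blocks $x_{n,j}^{c}<x_{n,j}^{d}<x_{n,j+1}^{d}<x_{n,j+1}^{c}$ for $j=m+3,m+5,\ldots,n-1$ (no such block if $m=1$), with $x_{n,j-1}^{c}<x_{n,j}^{c}$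 before each block.
   Context: $h_{C_n}(x)$ and $h_{D_n}(x)$ are the coordinator polynomials of types $C_n$ and $D_n$; equivalently, $h_{D_n}(x)=\frac{(1+\sqrt{x})^{2n}+(1-\sqrt{x})^{2n}}{2}-2nx(1+x)^{n-2}$. Both are polynomials of degree $n$. The labelling of the zeros in increasing order uses the fact (known from earlier literature) that, for $n\geqslant 3$, each of $h_{C_n}(x)$ and $h_{D_n}(x)$ has exactly $n$ distinct zeros, all of them real. *)

(* Defs.v *)
From HB Require Import structures.
From mathcomp Require Import all_boot all_order all_algebra.
From mathcomp Require Import reals.

Set Implicit Arguments.
Unset Strict Implicit.
Unset Printing Implicit Defensive.

Import Order.TTheory GRing.Theory Num.Theory.
Local Open Scope ring_scope.

(* Coordinator polynomials of types C_n and D_n. The exponent n - 2 is a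
   truncated subtraction, so hD is only meaningful for 2 <= n. *)
Definition hC (R : realType) (n : nat) : {poly R} :=
  \sum_(k < n.+1) 'C(2 * n, 2 * k)%:R *: 'X^k.

Definition hD (R : realType) (n : nat) : {poly R} :=
  hC R n - (2 * n)%:R *: ('X * (1 + 'X) ^+ (n - 2)).

(* x 1 < x 2 < ... < x n are exactly the zeros of p; the labels start at 1,
   and the values of x outside 1, ..., n are irrelevant. *)
Definition increasing_zeros (R : realType) (n : nat) (p : {poly R})
    (x : nat -> R) : Prop :=
  (forall i j : nat, (1 <= i)%N -> (i < j)%N -> (j <= n)%N -> x i < x j) /\
  (forall y : R, root p y <-> exists2 j : nat, (1 <= j <= n)%N & y = x j).

Definition block (R : realType) (xc xd : nat -> R) (j : nat) : Prop :=
  [/\ xc j < xd j, xd j < xd j.+1 & xd j.+1 < xc j.+1].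

(* Main.v *)
Require Import Defs.
From HB Require Import structures.
From mathcomp Require Import all_boot all_order all_algebra.
From mathcomp Require Import boolp reals trigo.
From mathcomp Require Import polyrcf.
From mathcomp Require Import ring lra zify.

Set Implicit Arguments.
Unset Strict Implicit.
Unset Printing Implicit Defensive.

Import Order.TTheory GRing.Theory Num.Theory.
Local Open Scope ring_scope.

(** At [x = - tan a ^+ 2] both polynomials become trigonometric:
    [hC.[x] * cos a ^+ (2 * n) = cos (2 n a)], and [hD.[x] * cos a ^+ (2 * n)]
    is the same cosine plus the bump
    [n / 2 * sin (2 a) ^+ 2 * cos (2 a) ^+ (n - 2)]
    ([hC_tan], [hD_tan]). By the weighted AM-GM inequality the bump is smaller
    than 1 in absolute value ([bump_lt1]), so wherever the cosine is [1] or
    [-1] it alone decides the sign of [hD].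

    Cut the range of [a] into equal steps of [pi / (4 n)]. This gives points
    [node i], increasing in [i] for [0 < i < 2 n]. The odd nodes are the [n]
    zeros of [hC]; there [hD] has the sign of the bump, which is [1] for
    [n < i] and [(-1) ^+ n] for [i < n] ([hD_node_odd]), while [i = n] gives
    the point [-1]. At the even nodes the cosine is [1] or [-1], so [hD] has
    the alternating sign [(-1) ^+ (n + l)] at [node (2 l)] ([hD_node_even]).
    Hence, for [2 j - 1 <> n], exactly one of the even neighbours
    [node (2 j - 2)] and [node (2 j)] of the zero [node (2 j - 1)] of [hC]
    carries the opposite sign of [hD], and the intermediate value theorem puts
    a zero of [hD] on that side ([hD_root_in_cell]). The intervals between
    successive even nodes being ordered, these [n] zeros are increasing, so
    they are the [n] zeros of [hD] with their labels
    ([increasing_zeros_unique]). Which side occurs is the parity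
    condition [right_shifted], and the three cases of the theorem unfold it. *)

(** * Increasing enumerations of zeros *)

(** The labels [k] with [y j = x k] increase with [j] inside [1, ..., n], which
    forces [k = j]: climbing from [1] gives [j <= k], descending from [n] gives
    [k <= j]. *)
Lemma increasing_zeros_unique (R : realType) n (p : {poly R}) (x y : nat -> R) :
    increasing_zeros n p x ->
    (forall i j : nat, (1 <= i)%N -> (i < j)%N -> (j <= n)%N -> y i < y j) ->
    (forall j, (1 <= j <= n)%N -> root p (y j)) ->
  forall j, (1 <= j <= n)%N -> x j = y j.
Proof.
move=> [x_incr x_roots] y_incr y_root.
have index_lt i k : (1 <= i <= n)%N -> (1 <= k <= n)%N -> x i < x k ->
    (i < k)%N.
  move=> /andP[i1 i_n] /andP[k1 k_n]; apply: contraTT; rewrite -leqNgt -leNgt.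
  by rewrite leq_eqVlt => /predU1P[->//|ki]; exact/ltW/x_incr.
have index_ge j : (1 <= j <= n)%N ->
    forall k, (1 <= k <= n)%N -> y j = x k -> (j <= k)%N.
  elim: j => [//|[_ _ k /andP[]//|j IH]] /andP[_ jn] k k_in yjk.
  have j_in : (1 <= j.+1 <= n)%N by rewrite /= ltnW.
  have /x_roots[k' k'_in yk'] := y_root _ j_in.
  apply: leq_ltn_trans (IH j_in k' k'_in yk') _.
  by apply: index_lt => //; rewrite -yk' -yjk; apply: y_incr.
have index_le d j : (n - j <= d)%N -> (1 <= j <= n)%N ->
    forall k, (1 <= k <= n)%N -> y j = x k -> (k <= j)%N.
  elim: d j => [|d IH] j jd j_in k k_in yjk; first by lia.
  have [jn|jn] := leqP n j; first by lia.
  have j_in' : (1 <= j.+1 <= n)%N by lia.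
  have /x_roots[k' k'_in yk'] := y_root _ j_in'.
  have : (k' <= j.+1)%N by apply: (IH j.+1) => //; lia.
  have : (k < k')%N.
    by apply: index_lt => //; rewrite -yk' -yjk; apply: y_incr => //; lia.
  lia.
move=> j j_in; have /x_roots[k k_in yk] := y_root _ j_in.
rewrite yk; congr (x _); apply/eqP.
by rewrite eqn_leq (index_ge _ j_in) // (index_le _ _ (leqnn _) j_in k).
Qed.

(** * Trigonometric form of the coordinator polynomials *)

(** De Moivre's formula without complex numbers: the even and odd parts of
    [(1 + 'X) ^+ N], taken at the square of [i tan a], are the real and
    imaginary parts of [(1 + i tan a) ^+ N]. *)
Lemma binomial_even_odd_tan (R : realType) (a : R) N : cos a != 0 ->
  (even_poly ((1 + 'X) ^+ N)).[- tan a ^+ 2] * cos a ^+ N = cos (a *+ N) /\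
  (odd_poly ((1 + 'X) ^+ N)).[- tan a ^+ 2] * cos a ^+ N * tan a = sin (a *+ N).
Proof.
move=> ca0; have tanE : sin a = tan a * cos a by rewrite mulfVK.
elim: N => [|N [IHe IHo]].
  rewrite !expr0 even_polyC odd_polyC !hornerC mulr0n cos0 sin0.
  by rewrite !mul0r mulr1.
rewrite mulrSr cosD sinD -IHe -IHo tanE exprSr mulrDr mulr1.
rewrite even_polyD odd_polyD even_polyMX odd_polyMX !(hornerD, hornerMX).
rewrite (exprS (cos a)); move: (tan a) (cos a) => t c.
by split; ring.
Qed.

Lemma hC_even_poly (R : realType) n : hC R n = even_poly ((1 + 'X) ^+ (2 * n)).
Proof.
have binomial : (1 + 'X) ^+ (2 * n) =
    \poly_(i < (2 * n).+1) 'C(2 * n, i)%:R :> {poly R}.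
  rewrite poly_def exprDn; apply: eq_bigr => i _.
  by rewrite expr1n mul1r scaler_nat.
have -> : hC R n = \poly_(k < n.+1) 'C(2 * n, 2 * k)%:R by rewrite poly_def.
apply/polyP => k.
by rewrite coef_even_poly binomial !coef_poly -mul2n !ltnS leq_pmul2l //.
Qed.

Lemma hC_tan (R : realType) (a : R) n : cos a != 0 ->
  (hC R n).[- tan a ^+ 2] * cos a ^+ (2 * n) = cos (a *+ (2 * n)).
Proof. by move=> ca0; rewrite hC_even_poly (binomial_even_odd_tan _ ca0).1. Qed.

(** With [t = tan a] and [c = cos a], the correction term of [hD] is rewritten
    using [sin (2 a) = 2 t c ^+ 2] and [cos (2 a) = (1 - t ^+ 2) c ^+ 2]; the
    factor [1 + x] thus turns into the cosine of the double angle. *)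
Lemma hD_tan (R : realType) (a : R) n : (2 <= n)%N -> cos a != 0 ->
  (hD R n).[- tan a ^+ 2] * cos a ^+ (2 * n) =
  cos (a *+ (2 * n)) + n%:R / 2 * sin (a *+ 2) ^+ 2 * cos (a *+ 2) ^+ (n - 2).
Proof.
move=> n2 ca0; have tanE : sin a = tan a * cos a by rewrite mulfVK.
have sinE : tan a ^+ 2 * cos a ^+ 2 = 1 - cos a ^+ 2.
  by rewrite -exprMn -tanE sin2cos2.
rewrite -hC_tan // /hD sin_mulr2n tanE cos_mulr2n.
move: (tan a) (cos a) => t c in sinE *.
rewrite !(hornerD, hornerN, hornerZ, hornerMX, horner_exp, hornerM, hornerX).
rewrite !hornerC.
have -> : c ^+ 2 *+ 2 - 1 = (1 - t ^+ 2) * c ^+ 2 by rewrite mulrBl sinE; ring.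
have -> : c ^+ (2 * n) = c ^+ 4 * (c ^+ 2) ^+ (n - 2).
  by rewrite -exprM -exprD; congr (_ ^+ _); lia.
rewrite (exprMn _ (1 - t ^+ 2)) natrM; by field.
Qed.

(** * The bump is smaller than one *)

(** AM-GM for [p] copies of [a ^+ p.+2] and two copies of [1]. In the induction
    on [p], the defect for [p.+1] exceeds [a] times the defect for [p] by
    [(1 - a) * (2 - a ^+ p.+1 * (1 + a))], which is nonnegative. *)
Lemma weighted_am_gm (R : realFieldType) (a : R) p : 0 <= a <= 1 ->
  p.+2%:R * a ^+ p <= p%:R * a ^+ p.+2 + 2.
Proof.
move=> /andP[a0 a1]; elim: p => [|p IH]; first by rewrite !expr0 mul0r; lra.
have ap0 : 0 <= a ^+ p.+1 by rewrite exprn_ge0.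
have ap1 : a ^+ p.+1 <= 1 by rewrite exprn_ile1.
have := ler_wpM2l a0 IH; rewrite !exprS in ap0 ap1 *.
rewrite -[p.+3]addn1 -[p.+2]addn1 -[in p.+1%:R]addn1 !natrD.
set b := a ^+ p in ap0 ap1 *; set q := p%:R => IH'.
have : 0 <= (1 - a) * (2 - a * b * (1 + a)) by apply: mulr_ge0; nra.
nra.
Qed.

(** For [c = `|cos a|] the claim is [n * c ^+ (n - 2) * (1 - c ^+ 2) < 2]. The
    weighted AM-GM inequality with [p = n - 2] gives the bound
    [2 - 2 * c ^+ n], which is strict enough unless [c = 0]. *)
Lemma bump_lt1 (R : realType) (a : R) n : (3 <= n)%N ->
  `|n%:R / 2 * sin a ^+ 2 * cos a ^+ (n - 2)| < 1.
Proof.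
move=> n3; rewrite normrM (normrM (n%:R / 2)) normf_div !normr_nat !normrX.
rewrite real_normK ?num_real // sin2cos2 -[cos a ^+ 2]real_normK ?num_real //.
have := cos_max a; move: `|cos a| (normr_ge0 (cos a)) => c c0 c1.
(* From here on [n - 2] is written [p.+1]; it is positive, which makes the bump
   vanish at [c = 0]. *)
have -> : n = (n - 2).+2 by lia.
have : (0 < n - 2)%N by lia.
case: (n - 2)%N => // p _; rewrite subn2 /=.
have := @weighted_am_gm _ c p.+1; rewrite c0 c1 => /(_ isT).
rewrite -[p.+3]addn2 exprD natrD.
have [->|c_neq0] := eqVneq c 0; first by rewrite exprS !mul0r !mulr0; lra.
have cp : 0 < c ^+ p.+1 by rewrite exprn_gt0 // lt_def c_neq0.
have cp2 : 0 < c ^+ p.+1 * c ^+ 2.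
  by rewrite mulr_gt0 // exprn_gt0 // lt_def c_neq0.
set u := c ^+ p.+1 in cp cp2 *; set v := c ^+ 2 in cp2 *; set q := p.+1%:R.
nra.
Qed.

(** * The nodes *)

(** The angle decreases in [i], so that [node n i] increases and the zeros come
    out in the order of their labels. *)
Definition angle (R : realType) (n i : nat) : R :=
  (2 * n - i)%:R * pi / (4 * n)%:R.

Definition node (R : realType) (n i : nat) : R := - tan (angle R n i) ^+ 2.

Lemma angle_itv (R : realType) n i : (0 < i < 2 * n)%N ->
  0 < angle R n i < pi / 2.
Proof.
move=> /andP[i0 i2n]; have n4 : 0 < (4 * n)%:R :> R by rewrite ltr0n; lia.
have pi0 := pi_gt0 R.
rewrite /angle divr_gt0 ?n4 ?mulr_gt0 ?ltr0n ?subn_gt0 //= ltr_pdivrMr //.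
have -> : pi / 2 * (4 * n)%:R = (2 * n)%:R * pi :> R by rewrite !natrM; field.
by rewrite ltr_pM2r // ltr_nat; lia.
Qed.

Lemma cos_angle_gt0 (R : realType) n i : (0 < i < 2 * n)%N ->
  0 < cos (angle R n i).
Proof.
move=> /(angle_itv R) /andP[a0 a_pi]; apply: cos_gt0_pihalf.
by rewrite a_pi andbT (lt_trans _ a0) // oppr_lt0 divr_gt0 ?pi_gt0.
Qed.

Lemma node_lt (R : realType) n i k : (0 < i)%N -> (i < k)%N -> (k < 2 * n)%N ->
  node R n i < node R n k.
Proof.
move=> i0 ik k2n.
have in_itv_tan m : (0 < m < 2 * n)%N ->
      angle R n m \in `](- (pi / 2)), (pi / 2)[.
  move=> /(angle_itv R) /andP[a0 a_pi]; rewrite in_itv /= a_pi andbT.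
  by rewrite (lt_trans _ a0) // oppr_lt0 divr_gt0 ?pi_gt0.
have k_in : (0 < k < 2 * n)%N by lia.
have i_in : (0 < i < 2 * n)%N by lia.
have tan_k : 0 < tan (angle R n k).
  rewrite divr_gt0 ?cos_angle_gt0 //; apply: sin_gt0_pihalf; exact: angle_itv.
have tan_lt : tan (angle R n k) < tan (angle R n i).
  rewrite ltr_tan ?in_itv_tan //.
  rewrite !ltr_pM2r ?invr_gt0 ?pi_gt0 ?ltr0n ?ltr_nat; lia.
by rewrite ltrN2 ltrXn2r // ltW // (lt_trans tan_k).
Qed.

Lemma node_le (R : realType) n i k : (0 < i)%N -> (i <= k)%N -> (k < 2 * n)%N ->
  node R n i <= node R n k.
Proof.
by move=> i0; rewrite leq_eqVlt => /predU1P[->//|ik] k2n; exact/ltW/node_lt.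
Qed.

Lemma angleM2n (R : realType) n i : (0 < n)%N ->
  angle R n i *+ (2 * n) = (2 * n - i)%:R * (pi / 2).
Proof.
move=> n0; rewrite -mulr_natr /angle !natrM; field.
by rewrite pnatr_eq0 -lt0n.
Qed.

Lemma cos_natrM_pi (R : realType) d : cos (d%:R * pi) = (-1) ^+ d :> R.
Proof.
by rewrite mulr_natl -[pi *+ d]add0r (alternatingn (@cosDpi R)) cos0 mulr1.
Qed.

Lemma cos_odd_pihalf (R : realType) k : odd k -> cos (k%:R * (pi / 2)) = 0 :> R.
Proof.
move=> k_odd; have -> : k%:R * (pi / 2) = pi / 2 + pi *+ k./2 :> R.
  rewrite -{1}[k]odd_double_half k_odd -mul2n natrD natrM -mulr_natl.
  by rewrite (_ : (nat_of_bool true)%:R = 1) //; field.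
by rewrite (alternatingn (@cosDpi R)) cos_pihalf mulr0.
Qed.

Lemma cos_even_pihalf (R : realType) d :
  cos ((2 * d)%:R * (pi / 2)) = (-1) ^+ d :> R.
Proof.
rewrite -cos_natrM_pi natrM; congr (cos _); by field.
Qed.

(** * Signs at the nodes *)

Lemma hC_node (R : realType) n i : odd i -> (0 < i < 2 * n)%N ->
  root (hC R n) (node R n i).
Proof.
move=> i_odd i_in; have ca := cos_angle_gt0 R i_in.
rewrite /root -(inj_eq (mulIf (expf_neq0 (2 * n) (lt0r_neq0 ca)))) mul0r.
rewrite hC_tan ?lt0r_neq0 // angleM2n; last by lia.
by rewrite cos_odd_pihalf // oddB; [rewrite oddM i_odd | lia].
Qed.

(** The cosine is [(-1) ^+ (n - l)] here, and the bump is too small to change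
    the sign. *)
Lemma hD_node_even (R : realType) n l : (3 <= n)%N -> (0 < l < n)%N ->
  0 < (-1) ^+ (n + l) * (hD R n).[node R n (2 * l)].
Proof.
move=> n3 l_in; have l2_in : (0 < 2 * l < 2 * n)%N by lia.
have ca := cos_angle_gt0 R l2_in.
rewrite -(pmulr_lgt0 _ (exprn_gt0 (2 * n) ca)) -mulrA.
rewrite hD_tan ?lt0r_neq0 //; last by lia.
rewrite angleM2n; last by lia.
rewrite -mulnBr cos_even_pihalf.
have -> : (-1) ^+ (n - l) = (-1) ^+ (n + l) :> R.
  by rewrite -signr_odd -[RHS]signr_odd oddD oddB //; lia.
have := bump_lt1 (angle R n (2 * l) *+ 2) n3.
move: (_ / 2 * _ * _) => g; rewrite ltr_norml => /andP[g1 g2].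
by rewrite -signr_odd; case: odd; rewrite ?expr0 ?expr1; lra.
Qed.

(** The cosine vanishes here and only the bump is left. Its sign is that of
    [cos (2 a) ^+ (n - 2)], where [2 a] passes [pi / 2] exactly at [i = n]. *)
Lemma hD_node_odd (R : realType) n i : (3 <= n)%N -> odd i ->
    (0 < i < 2 * n)%N -> i != n ->
  0 < (-1) ^+ (if (i < n)%N then n else 0) * (hD R n).[node R n i].
Proof.
move=> n3 i_odd i_in i_neq; have ca := cos_angle_gt0 R i_in.
rewrite -(pmulr_lgt0 _ (exprn_gt0 (2 * n) ca)) -mulrA.
rewrite hD_tan ?lt0r_neq0 //; last by lia.
rewrite angleM2n; last by lia.
rewrite cos_odd_pihalf ?add0r; last by rewrite oddB; [rewrite oddM i_odd | lia].
have /andP[a0 a_pi] := angle_itv R i_in; set a := angle R n i in a0 a_pi ca *.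
have s0 : 0 < n%:R / 2 * sin (a *+ 2) ^+ 2.
  rewrite mulr_gt0 ?exprn_gt0 ?divr_gt0 ?ltr0n //; first by lia.
  apply: sin_gt0_pi; rewrite mulr2n; lra.
rewrite mulrCA pmulr_rgt0 //.
have twice : a *+ 2 = (2 * n - i)%:R * pi / (2 * n)%:R.
  rewrite /a /angle !natrM; field; rewrite pnatr_eq0; lia.
have n2 : 0 < (2 * n)%:R :> R by rewrite ltr0n; lia.
have half : pi / 2 = n%:R * pi / (2 * n)%:R :> R.
  rewrite !natrM; field; rewrite pnatr_eq0; lia.
have pi0 := pi_gt0 R.
have [i_lt|i_ge] := ltnP i n.
  (* Here [2 a] lies in the second quadrant; subtracting [pi] brings it back to
     the interval where the cosine is known to be positive. *)
  have c_lt0 : 0 < - cos (a *+ 2).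
    have -> : - cos (a *+ 2) = cos (a *+ 2 - pi).
      by rewrite cosB cospi sinpi mulrN1 mulr0 addr0.
    have a_gt : pi / 2 < a *+ 2.
      by rewrite twice half !ltr_pM2r ?invr_gt0 ?ltr_nat //; lia.
    by apply: cos_gt0_pihalf; apply/andP; split; lra.
  have -> : (-1) ^+ n = (-1) ^+ (n - 2) :> R.
    by rewrite -signr_odd -[RHS]signr_odd oddB ?addbF //; lia.
  by rewrite -exprMn mulN1r exprn_gt0.
rewrite expr0 mul1r exprn_gt0 //; apply: cos_gt0_pihalf.
have a_lt : a *+ 2 < pi / 2.
  by rewrite twice half !ltr_pM2r ?invr_gt0 ?ltr_nat //; lia.
by apply/andP; split; lra.
Qed.

Lemma node_n (R : realType) n : (0 < n)%N -> node R n n = -1.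
Proof.
move=> n0; rewrite /node (_ : angle R n n = pi / 4).
  by rewrite tan_piquarter expr1n.
rewrite /angle mul2n -addnn addnK natrM; field.
by rewrite pnatr_eq0 -lt0n.
Qed.

(** The correction term of [hD] carries the factor [(1 + 'X) ^+ (n - 2)], so
    [-1] is a zero as soon as it is one of [hC], that is, for odd [n]. *)
Lemma hD_N1 (R : realType) n : (3 <= n)%N -> odd n -> root (hD R n) (-1).
Proof.
move=> n3 n_odd; have : root (hC R n) (-1).
  by rewrite -(@node_n R n); [apply: hC_node => //; lia | lia].
rewrite /root /hD => /eqP hC0.
rewrite !(hornerD, hornerN, hornerZ, hornerM, horner_exp, hornerX, hornerC).
rewrite hC0 subrr expr0n.
by rewrite (_ : (n - 2 == 0)%N = false) ?mulr0 ?subr0 //; apply/negP; lia.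
Qed.

Lemma opposite_signs (R : realDomainType) a b (u v : R) : odd (a + b) ->
  0 < (-1) ^+ a * u -> 0 < (-1) ^+ b * v -> u * v < 0.
Proof.
move=> ab_odd u0 v0; have := mulr_gt0 u0 v0.
by rewrite mulrACA -exprD -signr_odd ab_odd expr1 mulN1r oppr_gt0.
Qed.

(** * Location of the zeros *)

(** For [2 * j - 1 != n], the [j]-th zero of [hD] lies to the right of that of
    [hC] exactly when the sign of [hD] at [node n (2 * j)] is opposite to its
    sign at [node n (2 * j).-1]. Left of [-1] the latter is [(-1) ^+ n], and this means
    that [j] is odd; right of [-1] it is positive, and this means that
    [n + j] is odd. *)
Definition right_shifted n j := odd j (+) (odd n && (n < (2 * j).-1)%N).

(** The cell of [j = 1] is unbounded on the left and that of [j = n] ends at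
    [0]; the guards [1 < j] and [j < n] drop these two ends, which are not
    among the nodes with [0 < i < 2 n]. For [j = 1] the sign change is on the
    right of the zero of [hC], for [j = n] on its left, away from these ends. *)
Lemma hD_root_in_cell (R : realType) n j : (3 <= n)%N -> (1 <= j <= n)%N ->
  exists y, [/\ root (hD R n) y,
    (1 < j)%N -> node R n (2 * j - 2) < y,
    (j < n)%N -> y < node R n (2 * j) &
    if (2 * j).-1 == n then y = -1
    else if right_shifted n j then node R n (2 * j).-1 < y
    else y < node R n (2 * j).-1].
Proof.
move=> n3 j_in; set i := (2 * j).-1.
have i_odd : odd i by rewrite /i; lia.
have i_in : (0 < i < 2 * n)%N by rewrite /i; lia.
have [i_n|i_n] := eqVneq i n.
  have n_odd : odd n by rewrite -i_n.
  exists (-1); split; rewrite ?hD_N1 //.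
    by move=> j1; rewrite -(@node_n R n); [apply: node_lt|]; lia.
  by move=> jn; rewrite -(@node_n R n); [apply: node_lt|]; lia.
have sign_i := hD_node_odd R n3 i_odd i_in i_n.
case: (boolP (right_shifted n j)); rewrite /right_shifted => right_j.
  have jn : (0 < j < n)%N by lia.
  have i_j : node R n i < node R n (2 * j) by apply: node_lt; rewrite /i; lia.
  have sign_change : odd ((if i < n then n else 0) + (n + j))%N.
    by rewrite /i in i_n *; case: ifP; lia.
  have [y] := poly_ivtoo (ltW i_j)
    (opposite_signs sign_change sign_i (hD_node_even R n3 jn)).
  rewrite in_itv /= => /andP[iy yj] y_root; exists y; split=> // j1.
  by apply: lt_trans iy; apply: node_lt; rewrite /i; lia.
have j1n : (0 < j.-1 < n)%N by lia.
have j_i : node R n (2 * j.-1) < node R n i by apply: node_lt; rewrite /i; lia.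
have sign_change : odd (n + j.-1 + (if i < n then n else 0))%N.
  by rewrite /i in i_n *; case: ifP; lia.
have [y] := poly_ivtoo (ltW j_i)
  (opposite_signs sign_change (hD_node_even R n3 j1n) sign_i).
rewrite in_itv /= => /andP[jy yi] y_root; exists y; split=> // j1.
  by rewrite (_ : 2 * j - 2 = 2 * j.-1)%N //; lia.
by apply: lt_trans yi _; apply: node_lt; rewrite /i; lia.
Qed.

(** With the increasing order of each labelling, this comparison of equal labels
    yields every inequality of the three cases. *)
Lemma zeros_located (R : realType) n (xc xd : nat -> R) : (3 <= n)%N ->
    increasing_zeros n (hC R n) xc -> increasing_zeros n (hD R n) xd ->
  forall j, (1 <= j <= n)%N ->
    if (2 * j).-1 == n then xc j = -1 /\ xd j = -1
    else if right_shifted n j then xc j < xd j else xd j < xc j.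
Proof.
move=> n3 xcP xdP.
have /choice[y yP] j : exists y, (1 <= j <= n)%N -> [/\ root (hD R n) y,
    (1 < j)%N -> node R n (2 * j - 2) < y,
    (j < n)%N -> y < node R n (2 * j) &
    if (2 * j).-1 == n then y = -1
    else if right_shifted n j then node R n (2 * j).-1 < y
    else y < node R n (2 * j).-1].
  have [/(hD_root_in_cell R n3)[y]|] := boolP (1 <= j <= n)%N; last by exists 0.
  by exists y.
have xcE : forall j, (1 <= j <= n)%N -> xc j = node R n (2 * j).-1.
  apply: (increasing_zeros_unique xcP) => [i j i1 ij jn|j j_in].
    by apply: node_lt; lia.
  by apply: hC_node; lia.
have xdE : forall j, (1 <= j <= n)%N -> xd j = y j.
  apply: (increasing_zeros_unique xdP) => [i j i1 ij jn|j j_in]; last first.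
    by case: (yP j).
  have [|_ _ y_lt _] := yP i; first by lia.
  have [|_ lt_y _ _] := yP j; first by lia.
  apply: lt_le_trans (y_lt _) _; first by lia.
  apply: le_trans (ltW (lt_y _)); last by lia.
  by apply: node_le; lia.
move=> j j_in; rewrite xcE // xdE //.
have [_ _ _] := yP j j_in; case: eqP => [->|//].
by rewrite node_n //; lia.
Qed.

Theorem theorem1 (R : realType) (n : nat) (xc xd : nat -> R)
    (n_ge3 : (3 <= n)%N)
    (xcP : increasing_zeros n (hC R n) xc)
    (xdP : increasing_zeros n (hD R n) xd) :
  (forall m : nat, n = (2 * m)%N ->
     (forall j : nat, odd j -> (1 <= j <= n - 1)%N -> block xc xd j) /\
     (forall j : nat, odd j -> (1 <= j <= n - 3)%N -> xc j.+1 < xc j.+2)) /\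
  (forall m : nat, n = (2 * m + 1)%N -> ~~ odd m ->
     (xc m.+1 = -1 /\ xd m.+1 = -1) /\
     ((forall j : nat, odd j -> (1 <= j <= m - 1)%N -> block xc xd j) /\
      (forall j : nat, odd j -> (1 <= j <= m - 3)%N -> xc j.+1 < xc j.+2) /\
      xc m < -1) /\
     (-1 < xc m.+2 /\
      (forall j : nat, ~~ odd j -> (m + 2 <= j <= n - 1)%N -> block xc xd j) /\
      (forall j : nat, ~~ odd j -> (m + 2 <= j <= n - 3)%N ->
         xc j.+1 < xc j.+2))) /\
  (forall m : nat, n = (2 * m + 1)%N -> odd m ->
     (xc m.+1 = -1 /\ xd m.+1 = -1) /\
     ((forall j : nat, odd j -> (1 <= j <= m - 2)%N ->
         block xc xd j /\ xc j.+1 < xc j.+2) /\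
      xc m < xd m /\ xd m < -1) /\
     (-1 < xd m.+2 /\ xd m.+2 < xc m.+2 /\
      (forall j : nat, ~~ odd j -> (m + 3 <= j <= n - 1)%N ->
         xc j.-1 < xc j /\ block xc xd j))).
Proof.
have located := zeros_located n_ge3 xcP xdP.
have [xc_incr _] := xcP; have [xd_incr _] := xdP.
have xcS j : (1 <= j < n)%N -> xc j < xc j.+1.
  by move=> j_in; apply: xc_incr; lia.
have xdS j : (1 <= j < n)%N -> xd j < xd j.+1.
  by move=> j_in; apply: xd_incr; lia.
have xc_lt_xd j : (1 <= j <= n)%N -> (2 * j).-1 != n -> right_shifted n j ->
    xc j < xd j.
  by move=> /located + /negPf jn rj; rewrite jn rj.
have xd_lt_xc j : (1 <= j <= n)%N -> (2 * j).-1 != n -> ~~ right_shifted n j ->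
    xd j < xc j.
  by move=> /located + /negPf jn /negPf rj; rewrite jn rj.
have block_at j : (1 <= j < n)%N -> (2 * j).-1 != n -> (2 * j.+1).-1 != n ->
    right_shifted n j -> ~~ right_shifted n j.+1 -> block xc xd j.
  move=> j_in jn jn' rj rj'.
  by split; [apply: xc_lt_xd|apply: xdS|apply: xd_lt_xc] => //; lia.
have mid m : n = (2 * m + 1)%N -> xc m.+1 = -1 /\ xd m.+1 = -1.
  move=> nm; have := located m.+1; rewrite ifT; first by apply; lia.
  by apply/eqP; lia.
rewrite /right_shifted in xc_lt_xd xd_lt_xc block_at.
split=> [m nm|].
  split=> j j_odd j_in; last by apply: xcS; lia.
  by apply: block_at; lia.
split=> m nm m_odd; have [xcm xdm] := mid m nm; split=> //.
  split; [split; [|split]|split; [|split]].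
  - by move=> j j_odd j_in; apply: block_at; lia.
  - by move=> j j_odd j_in; apply: xcS; lia.
  - by rewrite -xcm; apply: xcS; lia.
  - by rewrite -xcm; apply: xcS; lia.
  - by move=> j j_odd j_in; apply: block_at; lia.
  - by move=> j j_odd j_in; apply: xcS; lia.
split; [split; [|split]|split; [|split]].
- by move=> j j_odd j_in; split; [apply: block_at|apply: xcS]; lia.
- by apply: xc_lt_xd; lia.
- by rewrite -xdm; apply: xdS; lia.
- by rewrite -xdm; apply: xdS; lia.
- by apply: xd_lt_xc; lia.
- move=> j j_odd j_in; split; last by apply: block_at; lia.
  by rewrite -{2}[j](@prednK j); [apply: xcS; lia|lia].
Qed.
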